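(* Let $n_A,n_B\ge1$, let $H\in\mathbb{C}^{(n_An_B)\times(n_An_B)}$ be the Hermitian payoff Hamiltonian of a zero-sum quantum game on $\mathbb{C}^{n_A}\otimes\mathbb{C}^{n_B}$ (player $A$ minimizes, player $B$ maximizes the payoff $\operatorname{tr}((\rho_A\otimes\rho_B)H)$), and let $\Delta\ge0$ be the deception budget. Consider the bilinear semidefinite program $$\min_{\rho_A,\Omega\in\mathbb{C}^{n_A\times n_A},\ \rho_B\in\mathbb{C}^{n_B\times n_B},\ D\in\mathbb{C}^{(n_An_B)\times(n_An_B)},\ u\in\mathbb{R}}\ \operatorname{tr}\big((\rho_A\otimes\rho_B)H\big)$$ subject to $\operatorname{tr}_B\big((I_A\otimes\rho_B)(H+D)\big)\succeq u\,I_A$, $\operatorname{tr}_A\big((\Omega\otimes I_B)(H+D)\big)\preceq u\,I_B$, $D=D^\dagger$, $\|D\|_1\le\Delta$, $\rho_A,\rho_B,\Omega\succeq0$, and $\operatorname{tr}(\rho_A)=\operatorname{tr}(\rho_B)=\operatorname{tr}(\Omega)=1$. If $(\rho_A^\star,D^\star,\rho_B^\star,\Omega^\star,u^\star)$ is an optimal solution of this program, then $(\rho_A^\star,D^\star,\rho_B^\star)$ is an optimal solution of the bilevel quantum deception problem $$\min_{\rho_A\in\mathcal{P}_A,\ \rho_B\in\mathcal{P}_B,\ D\in\mathcal{D}}\ \operatorname{tr}\big((\rho_A\otimes\rho_B)H\big)\quad\text{s.t.}\quad \rho_B\in\Phi_B(H+D).$$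
   Context: $\mathcal{P}_A$ (resp. $\mathcal{P}_B$) denotes the set of $n_A\times n_A$ (resp. $n_B\times n_B$) complex positive semidefinite matrices of trace one (density matrices). $\mathcal{D}=\{D\in\mathbb{C}^{(n_An_B)\times(n_An_B)}:D=D^\dagger,\ \|D\|_1\le\Delta\}$, where $\|A\|_1=\sup_{\|x\|_1=1}\|Ax\|_1$ is the matrix norm induced by the vector $1$-norm. For a Hermitian $H'$, $\Phi_B(H')=\operatorname*{arg\,max}_{\rho_B\in\mathcal{P}_B}\min_{\rho_A\in\mathcal{P}_A}\operatorname{tr}((\rho_A\otimes\rho_B)H')$ is the set of security policies of the maximizing player $B$ in the zero-sum game with payoff Hamiltonian $H'$. $\operatorname{tr}_A,\operatorname{tr}_B$ are the partial traces over the factors $\mathbb{C}^{n_A}$ and $\mathbb{C}^{n_B}$; $I_A=I_{n_A}$, $I_B=I_{n_B}$; $\succeq$ is the Loewner order. *)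

(* Defs.v *)
From HB Require Import structures.
From mathcomp Require Import all_boot all_order all_algebra.
From mathcomp Require Import reals.
From mathcomp Require Import complex mxtens.
Set Implicit Arguments. Unset Strict Implicit. Unset Printing Implicit Defensive.
Import Order.TTheory GRing.Theory Num.Theory.
Local Open Scope ring_scope.
Local Open Scope complex_scope.

Section QDefs.
Variable R : realType.
Local Notation C := R[i].

Definition adj {m n} (A : 'M[C]_(m, n)) : 'M[C]_(n, m) := (map_mx conjc A)^T.

Definition is_hermitian {n} (A : 'M[C]_n) : Prop := adj A = A.

(* positive semidefinite: Hermitian and x^dagger A x >= 0 for all x
   (order on C: z >= 0 iff z is real and nonnegative) *)
Definition psd {n} (A : 'M[C]_n) : Prop :=
  is_hermitian A /\ forall x : 'cV[C]_n, 0 <= (adj x *m A *m x) 0 0.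

Definition loewner_ge {n} (A B : 'M[C]_n) : Prop := psd (A - B).

Definition density {n} (A : 'M[C]_n) : Prop := psd A /\ \tr A = 1.

Definition ptraceB {nA nB} (X : 'M[C]_(nA * nB)) : 'M[C]_nA :=
  \matrix_(i, j) \sum_(k < nB) X (mxtens_index (i, k)) (mxtens_index (j, k)).
Definition ptraceA {nA nB} (X : 'M[C]_(nA * nB)) : 'M[C]_nB :=
  \matrix_(i, j) \sum_(k < nA) X (mxtens_index (k, i)) (mxtens_index (k, j)).

Definition vnorm1 {n} (x : 'cV[C]_n) : C := \sum_(i < n) `|x i 0|.

(* ||D||_1 <= Delta, for the norm induced by the vector 1-norm:
   sup_{||x||_1 = 1} ||D x||_1 <= Delta *)
Definition induced_norm1_le {n} (D : 'M[C]_n) (Delta : R) : Prop :=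
  forall x : 'cV[C]_n, vnorm1 x = 1 -> vnorm1 (D *m x) <= Delta%:C.

Definition deception_set {n} (Delta : R) (D : 'M[C]_n) : Prop :=
  is_hermitian D /\ induced_norm1_le D Delta.

(* payoff tr((rhoA (x) rhoB) H) (real for Hermitian H; we take its real part) *)
Definition payoff {nA nB} (H : 'M[C]_(nA * nB)) (rA : 'M[C]_nA) (rB : 'M[C]_nB) : R :=
  complex.Re (\tr ((rA *t rB) *m H)).

Definition is_min_value {nA nB} (H : 'M[C]_(nA * nB)) (rB : 'M[C]_nB) (v : R) : Prop :=
  (exists rA : 'M[C]_nA, density rA /\ payoff H rA rB = v) /\
  (forall rA : 'M[C]_nA, density rA -> v <= payoff H rA rB).

Definition in_PhiB {nA nB} (H : 'M[C]_(nA * nB)) (rB : 'M[C]_nB) : Prop :=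
  density rB /\
  exists v, is_min_value (nA := nA) H rB v /\
    forall (rB' : 'M[C]_nB) (v' : R), density rB' -> is_min_value (nA := nA) H rB' v' -> v' <= v.

Definition sdp_feasible {nA nB} (H : 'M[C]_(nA * nB)) (Delta : R)
  (rA : 'M[C]_nA) (D : 'M[C]_(nA * nB)) (rB : 'M[C]_nB) (Om : 'M[C]_nA) (u : R) : Prop :=
  [/\ loewner_ge (ptraceB (nB := nB) ((1%:M *t rB) *m (H + D))) (u%:C)%:M,
      loewner_ge (u%:C)%:M (ptraceA (nA := nA) ((Om *t 1%:M) *m (H + D))),
      (is_hermitian D /\ induced_norm1_le D Delta),
      [/\ psd rA, psd rB & psd Om] &
      [/\ \tr rA = 1, \tr rB = 1 & \tr Om = 1]].

Definition sdp_optimal {nA nB} (H : 'M[C]_(nA * nB)) (Delta : R)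
  (rA : 'M[C]_nA) (D : 'M[C]_(nA * nB)) (rB : 'M[C]_nB) (Om : 'M[C]_nA) (u : R) : Prop :=
  sdp_feasible H Delta rA D rB Om u /\
  forall rA' D' rB' Om' u', sdp_feasible H Delta rA' D' rB' Om' u' ->
    payoff H rA rB <= payoff H rA' rB'.

Definition bilevel_feasible {nA nB} (H : 'M[C]_(nA * nB)) (Delta : R)
  (rA : 'M[C]_nA) (D : 'M[C]_(nA * nB)) (rB : 'M[C]_nB) : Prop :=
  [/\ density rA, density rB, deception_set Delta D & in_PhiB (H + D) rB].

Definition bilevel_optimal {nA nB} (H : 'M[C]_(nA * nB)) (Delta : R)
  (rA : 'M[C]_nA) (D : 'M[C]_(nA * nB)) (rB : 'M[C]_nB) : Prop :=
  bilevel_feasible H Delta rA D rB /\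
  forall rA' D' rB', bilevel_feasible H Delta rA' D' rB' ->
    payoff H rA rB <= payoff H rA' rB'.

End QDefs.

(* Main.v *)
Require Import Defs.
From HB Require Import structures.
From mathcomp Require Import all_boot all_order all_algebra.
From mathcomp Require Import spectral.
From mathcomp Require Import all_classical.
From mathcomp Require Import reals.
From mathcomp Require Import topology normedtype derive.
From mathcomp Require Import complex mxtens.
From mathcomp Require Import ring lra.
Import Order.TTheory GRing.Theory Num.Theory.
Import numFieldNormedType.Exports.
Local Open Scope classical_set_scope.
Local Open Scope ring_scope.
Local Open Scope complex_scope.
Set Implicit Arguments. Unset Strict Implicit. Unset Printing Implicit Defensive.

(** Write K = H + D. Since tr((rA (x) rB) K) = tr(rA tr_B((1 (x) rB) K)), and a
    Hermitian matrix is psd iff its trace against every density matrix is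
    nonnegative, the two Loewner constraints say exactly that u is a lower bound
    of the payoff of K against rB and an upper bound of the payoff of Om. Such a
    pair (Om, u) certifies that rB is a security policy; conversely the minimax
    theorem provides one for every security policy. Hence the two programs have
    the same feasible (rA, D, rB), and the same objective. *)

(** First-order optimality: for small t the linear term dominates, so a negative [b] would make the
    quadratic negative. *)
Lemma linear_coef_ge0 (R : realFieldType) (b c : R) :
  (forall t, 0 <= t <= 1 -> 0 <= t * b + t ^+ 2 * c) -> 0 <= b.
Proof.
move=> h; rewrite leNgt; apply/negP => b0.
have c0 : 0 < c by have := h 1; rewrite ler01 lexx => /(_ isT); lra.
have cb : 0 < c - b by lra.
(* The bound at t = 1 gave c >= - b > 0. This choice makes t (c - b) = - b / 2, hence t c < - b / 2
   and b + t c < 0. *)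
pose t := - b / (2 * (c - b)).
have t0 : 0 < t by rewrite divr_gt0 // ?mulr_gt0 //; lra.
have t1 : t <= 1 by rewrite ler_pdivrMr; lra.
have tE : t * (2 * (c - b)) = - b by rewrite divfK //; lra.
have := h t; rewrite t1 ltW // => /(_ isT).
by rewrite leNgt => /negP; apply; nra.
Qed.

(** * A minimax theorem of Ky Fan type for convexlike-concavelike payoffs *)

Section Minimax.
Variables (R : realType) (T : ptopologicalType) (I : choiceType).
Variables (X : set T) (Y : set I) (f : T -> I -> R) (v : R).

Hypothesis X0 : X !=set0.
Hypothesis cptX : compact X.
Hypothesis f_cont : forall y, Y y -> continuous (f^~ y).
Hypothesis f_convexlike : forall x x' t, X x -> X x' -> 0 <= t <= 1 ->
  exists2 z, X z & forall y, Y y -> f z y <= (1 - t) * f x y + t * f x' y.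
Hypothesis f_concavelike : forall (s : seq I) (w : I -> R),
  (forall y, y \in s -> Y y) -> (forall y, 0 <= w y) -> \sum_(y <- s) w y = 1 ->
  exists2 z, Y z & forall x, X x -> \sum_(y <- s) w y * f x y <= f x z.
Hypothesis f_lower : forall y, Y y -> exists2 x, X x & f x y <= v.

(* A minimiser over X of the squared positive parts works: if the minimum were
   positive, the positive parts there would be weights separating X from v. *)
Lemma minimax_seq (s : seq I) : (forall y, y \in s -> Y y) ->
  exists2 x, X x & forall y, y \in s -> f x y <= v.
Proof.
move=> sY; pose p x y := Num.max 0 (f x y - v).
pose g x := \sum_(y <- s) p x y ^+ 2.
have p0 x y : 0 <= p x y by rewrite le_max lexx.
have gcont : continuous g.
  (* Continuity of [f] in [x] is known only for [y] in [Y], so membership in [s] is kept as a guard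
     of the sum. *)
  rewrite (_ : g = fun x => \sum_(y <- s | y \in s) p x y ^+ 2); last first.
    by apply/funext => x'; rewrite /g big_seq.
  apply: continuous_big => [|y ys x]; first exact: add_continuous.
  have pc : p^~ y @ x --> p x y.
    apply: (@continuous_max _ _ (fun=> 0) (fun x => f x y - v)); first exact: cvg_cst.
    by apply: cvgB; [exact: f_cont (sY _ ys) _|exact: cvg_cst].
  exact: (cvgM pc pc).
have [c /set_mem Xc cmin] := compact_EVT_min X0 cptX (continuous_subspaceT gcont).
have [g0|g0] := eqVneq (g c) 0.
  exists c => // y ys.
  move/eqP: g0; rewrite psumr_eq0 => [/allP/(_ _ ys)|i _]; last exact: sqr_ge0.
  rewrite /= sqrf_eq0 => /eqP pc; have : f c y - v <= p c y by rewrite le_max lexx orbT.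
  by rewrite pc subr_le0.
have gpos : 0 < g c.
  by rewrite lt_neqAle eq_sym g0 sumr_ge0 // => i _; exact: sqr_ge0.
pose W := \sum_(y <- s) p c y.
have Wpos : 0 < W.
  rewrite lt_neqAle sumr_ge0 // andbT eq_sym; apply: contra g0.
  rewrite psumr_eq0 // => /allP h; rewrite /g big_seq big1 // => y ys.
  by have /eqP -> := h _ ys; rewrite expr0n.
(* Half the one-sided derivative at [c] towards [x] is nonnegative by minimality; the term [g c]
   appears because [p c y * (f c y - v)] equals [p c y ^+ 2]. *)
have key x : X x -> g c <= \sum_(y <- s) p c y * (f x y - v).
  move=> Xx; have : 0 <= 2 * \sum_(y <- s) p c y * (f x y - f c y).
    apply: (@linear_coef_ge0 _ _ (\sum_(y <- s) (f x y - f c y) ^+ 2)) => t t01.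
    (* Convexity bounds [f z y - v] by [p c y + t * (f x y - f c y)], so the square of its positive
       part is at most the square of that affine function of [t]. Summing bounds [g z] by a
       quadratic in [t] with value [g c] at 0. *)
    have [z Xz zle] := f_convexlike Xc Xx t01.
    have : g c <= g z by apply: cmin; rewrite inE.
    rewrite mulrA !mulr_sumr -big_split /= -subr_ge0 /g -sumrB => /le_trans; apply.
    rewrite big_seq [leRHS]big_seq; apply: ler_sum => y ys.
    have := zle _ (sY _ ys).
    have : f c y - v <= p c y by rewrite le_max lexx orbT.
    move: (p0 c y); move: (p c y) => q; rewrite /p => q0 hq hz.
    have := sqr_ge0 (q + t * (f x y - f c y)).
    case: (ltP 0 (f z y - v)) => fz ?; last by nra.
    have : 0 <= (q + t * (f x y - f c y)) - (f z y - v) by nra.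
    have : 0 <= (q + t * (f x y - f c y)) + (f z y - v) by nra.
    by move=> /mulr_ge0 h /h; nra.
  rewrite pmulr_rge0 // => h.
  suff -> : \sum_(y <- s) p c y * (f x y - v) =
            g c + \sum_(y <- s) p c y * (f x y - f c y) by rewrite lerDl.
  rewrite /g -big_split /=; apply: eq_bigr => y _.
  by rewrite /p; case: (ltP 0 (f c y - v)) => _; ring.
(* The normalised weights [p c y / W] mix [s] into one [z] of [Y]. A reply to [z] with payoff at
   most [v] then has weighted average at most [v], against [key] and [0 < g c]. *)
have [||z Yz zge] := @f_concavelike s (fun y => p c y / W) sY.
- by move=> y; rewrite divr_ge0 // ltW.
- by rewrite -mulr_suml divff // gt_eqF.
have [x Xx fx] := f_lower Yz.
have := le_trans (zge _ Xx) fx; rewrite leNgt => /negP[].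
have := key _ Xx; rewrite (eq_bigr (fun y => p c y * f x y - p c y * v)); last first.
  by move=> y _; rewrite mulrBr.
rewrite sumrB -mulr_suml -/W => h.
rewrite (eq_bigr (fun y => (p c y * f x y) / W)); last by move=> y _; rewrite mulrAC.
by rewrite -mulr_suml ltr_pdivlMr // mulrC -subr_gt0; exact: lt_le_trans h.
Qed.

(** The sublevel sets in [X] are closed, and [minimax_seq] gives them the finite intersection
    property; compactness yields a common point. *)
Lemma minimax : exists2 x, X x & forall y, Y y -> f x y <= v.
Proof.
(* An empty intersection would not force its points into [X], hence the separate case of empty
   [Y]. *)
have [[y0 Yy0]|/forallNP Y0] := pselect (exists y, Y y); last first.
  by have [x Xx] := X0; exists x => // y /Y0.
have := cptX; rewrite compact_In0.
move=> /(_ I Y (fun y => X `&` [set x | f x y <= v])) [].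
- exists (fun y => [set x | f x y <= v]) => // y Yy.
  apply: (@preimage_closed _ _ (f^~ y) [set r | r <= v]); last exact: closed_le.
  by move=> x _; exact: f_cont.
- move=> D DY; have [|x Xx xD] := @minimax_seq (finmap.enum_fset D).
    by move=> y /DY /set_mem.
  by exists x => y /= yD; split => //; exact: xD.
- by move=> x xP; exists x => [|y /xP []//]; have [] := xP _ Yy0.
Qed.

End Minimax.

(** * Hermitian matrices, positivity and the Loewner order tested by traces *)

Section Matrices.
Variable R : realType.
Local Notation C := R[i].

Lemma adjE m n (A : 'M[C]_(m, n)) i j : adj A i j = conjc (A j i).
Proof. by rewrite !mxE. Qed.

Lemma adjM m n p (A : 'M[C]_(m, n)) (B : 'M[C]_(n, p)) :
  adj (A *m B) = adj B *m adj A.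
Proof. by rewrite /adj map_mxM trmx_mul. Qed.

Lemma adjK m n (A : 'M[C]_(m, n)) : adj (adj A) = A.
Proof. by apply/matrixP => i j; rewrite !mxE conjcK. Qed.

Lemma adjB m n (A B : 'M[C]_(m, n)) : adj (A - B) = adj A - adj B.
Proof. by rewrite /adj map_mxB linearB. Qed.

Lemma hermitianP n (A : 'M[C]_n) :
  is_hermitian A <-> forall i j, conjc (A j i) = A i j.
Proof.
split=> [hA i j|hA]; first by rewrite -[in RHS]hA !mxE.
by apply/matrixP => i j; rewrite !mxE hA.
Qed.

Lemma adj_form n (M : 'M[C]_n) (x : 'cV[C]_n) : is_hermitian M ->
  conjc ((adj x *m M *m x) 0 0) = (adj x *m M *m x) 0 0.
Proof.
move=> hM; apply: (hermitianP _).1.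
by rewrite /is_hermitian !adjM adjK hM mulmxA.
Qed.

Lemma row_form_diag m n (P : 'M[C]_(m, n)) (B : 'M[C]_n) i :
  (row i P *m B *m adj (row i P)) 0 0 = (P *m B *m adj P) i i.
Proof. by rewrite -row_mul !mxE; apply: eq_bigr => k _; rewrite !mxE. Qed.

(** Spectral theorem for normal matrices; each eigenvalue is the value of the quadratic form at a
    unit eigenvector, the adjoint of a row of [P]. *)
Lemma psd_spectral n (A : 'M[C]_n) : psd A ->
  exists (P : 'M[C]_n) (d : 'rV[C]_n),
    A = adj P *m diag_mx d *m P /\ forall i, 0 <= d 0 i.
Proof.
case=> hA pA.
have aE m p (M : 'M[C]_(m, p)) : map_mx Num.conj M^T = adj M by rewrite -map_trmx.
have nA : A \is normalmx by apply/normalmxP; rewrite aE hA.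
move: (spectral_unitarymx A) (orthomx_spectralP nA).
move: (spectralmx A) (spectral_diag A) => P d uP.
rewrite (invmx_unitary uP) aE => AE; exists P, d; split=> // i.
have PP : P *m adj P = 1%:M by rewrite -aE; exact/unitarymxP.
have dE : P *m A *m adj P = diag_mx d.
  by rewrite AE !mulmxA PP mul1mx -mulmxA PP mulmx1.
have := pA (adj (row i P)); rewrite adjK row_form_diag dE.
by rewrite !mxE eqxx mulr1n.
Qed.

(** Diagonalising [A] turns the trace into the sum of its eigenvalues times values of the form of
    [B] at the eigenvectors. *)
Lemma tr_psd_mul_ge0 n (A B : 'M[C]_n) : psd A -> psd B -> 0 <= \tr (A *m B).
Proof.
move=> /psd_spectral [P [d [-> d0]]] [_ pB].
rewrite -!mulmxA mxtrace_mulC -mulmxA mul_diag_mx.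
apply: sumr_ge0 => i _; rewrite mxE mulr_ge0 //.
have := pB (adj (row i P)); by rewrite adjK row_form_diag.
Qed.

Lemma adj_self_gt0 n (x : 'cV[C]_n) : x != 0 -> 0 < (adj x *m x) 0 0.
Proof.
move=> /matrix0Pn [i [j]]; rewrite ord1 {j} => xi0.
rewrite mxE (bigD1 i) //= ltr_pwDl //.
  rewrite !mxE mulrC -sqr_normc exprn_gt0 // normr_gt0 //.
by apply: sumr_ge0 => k _; rewrite !mxE mulrC mulcJ_ge0.
Qed.

Lemma tr_rank1 n (x : 'cV[C]_n) (M : 'M[C]_n) :
  \tr (x *m adj x *m M) = (adj x *m M *m x) 0 0.
Proof. by rewrite -mulmxA mxtrace_mulC trace_mx11. Qed.

Lemma density_rank1 n (x : 'cV[C]_n) : x != 0 ->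
  density (((adj x *m x) 0 0)^-1 *: (x *m adj x)).
Proof.
move=> /adj_self_gt0; set c := (adj x *m x) 0 0 => c0.
have cR : conjc c^-1 = c^-1.
  have : (0 : C) <= c^-1 by rewrite invr_ge0 ltW.
  by case: (c^-1) => a b /ger0_Im /= ->; rewrite oppr0.
split; last first.
  rewrite mxtraceZ -[x *m adj x]mulmx1 tr_rank1 mulmx1 -/c mulVf //.
  by rewrite gt_eqF.
split=> [|y].
  rewrite /is_hermitian /adj map_mxZ linearZ /= cR; congr (_ *: _).
  by have := adjM x (adj x); rewrite adjK.
rewrite -scalemxAr -scalemxAl mxE mulr_ge0 ?invr_ge0 ?(ltW c0) //.
(* Up to the positive factor, the form at [y] is the squared modulus of [adj x *m y]. *)
rewrite mulmxA -(mulmxA (adj y *m x)) mxE big_ord1.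
have -> : (adj y *m x) 0 0 = conjc ((adj x *m y) 0 0).
  by rewrite -adjE adjM adjK.
by rewrite mulrC mulcJ_ge0.
Qed.

(** The converse tests [M] on the rank-one densities, whose traces are normalised values of the
    quadratic form. Real parts suffice, since the form of a Hermitian matrix is real. *)
Lemma psdP n (M : 'M[C]_n) : is_hermitian M ->
  psd M <-> forall r : 'M[C]_n, density r -> 0 <= complex.Re (\tr (r *m M)).
Proof.
move=> hM; split=> [pM r [pr _]|h].
  by have := tr_psd_mul_ge0 pr pM; rewrite lecE => /andP[].
split=> // x; have [->|x0] := eqVneq x 0; first by rewrite mulmx0 mxE.
have := h _ (density_rank1 x0); rewrite -scalemxAl mxtraceZ tr_rank1.
have := adj_self_gt0 x0; set q := (adj x *m M *m x) 0 0.
have : conjc q = q by exact: adj_form.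
case: ((adj x *m x) 0 0) => c c'; case: q => a b [bE].
rewrite ltcE /= => /andP[/eqP -> c0].
have -> : b = 0 by lra.
rewrite lecE /= eqxx /= !mul0r mulr0 subr0 expr0n /= addr0.
by rewrite expr2 invfM mulrA divff ?gt_eqF // mul1r pmulr_rge0 ?invr_gt0.
Qed.

Lemma hermitian_scalar n (c : R) : is_hermitian (c%:C%:M : 'M[C]_n).
Proof.
apply/hermitianP => i j; rewrite !mxE eq_sym.
by case: eqP => _; rewrite ?mulr1n ?mulr0n ?conjc_real ?conjc0.
Qed.

Lemma Re_tr_scalar n (r : 'M[C]_n) (c : R) : density r ->
  complex.Re (\tr (r *m c%:C%:M)) = c.
Proof. by case=> _ tr1; rewrite mul_mx_scalar mxtraceZ tr1 mulr1. Qed.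

Lemma ReB (a b : C) : complex.Re (a - b) = complex.Re a - complex.Re b.
Proof. by case: a b => [? ?] [? ?]. Qed.

(** Apply [psdP] to the difference: densities have trace one, so the scalar matrix contributes
    exactly [c]. *)
Lemma loewner_ge_scalarP n (M : 'M[C]_n) (c : R) : is_hermitian M ->
  loewner_ge M c%:C%:M <->
  forall r : 'M[C]_n, density r -> c <= complex.Re (\tr (r *m M)).
Proof.
move=> hM; have hMc : is_hermitian (M - c%:C%:M).
  by rewrite /is_hermitian adjB hM hermitian_scalar.
split=> [/(psdP hMc) h r dr|h].
  by have := h r dr; rewrite mulmxBr linearB /= ReB Re_tr_scalar // subr_ge0.
by apply/(psdP hMc) => r dr; rewrite mulmxBr linearB /= ReB Re_tr_scalar // subr_ge0 h.
Qed.

Lemma scalar_loewner_geP n (M : 'M[C]_n) (c : R) : is_hermitian M ->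
  loewner_ge c%:C%:M M <->
  forall r : 'M[C]_n, density r -> complex.Re (\tr (r *m M)) <= c.
Proof.
move=> hM; have hMc : is_hermitian (c%:C%:M - M).
  by rewrite /is_hermitian adjB hM hermitian_scalar.
split=> [/(psdP hMc) h r dr|h].
  by have := h r dr; rewrite mulmxBr linearB /= ReB Re_tr_scalar // subr_ge0.
by apply/(psdP hMc) => r dr; rewrite mulmxBr linearB /= ReB Re_tr_scalar // subr_ge0 h.
Qed.

(** * Partial traces and the payoff *)

Lemma sum_mxtens_index (V : zmodType) nA nB (F : 'I_(nA * nB) -> V) :
  \sum_i F i = \sum_(a < nA) \sum_(b < nB) F (mxtens_index (a, b)).
Proof.
rewrite pair_big /= (reindex (@mxtens_index nA nB)) /=; last first.
  exists (@mxtens_unindex nA nB) => i _; [exact: mxtens_indexK | exact: mxtens_unindexK].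
by apply: eq_bigr => -[].
Qed.

Lemma ptraceBE nA nB (K : 'M[C]_(nA * nB)) (rB : 'M[C]_nB) i j :
  ptraceB (nB := nB) ((1%:M *t rB) *m K) i j =
  \sum_k \sum_l rB k l * K (mxtens_index (i, l)) (mxtens_index (j, k)).
Proof.
rewrite mxE; apply: eq_bigr => k _; rewrite mxE sum_mxtens_index.
rewrite (bigD1 i) //= [X in _ + X]big1 ?addr0 => [|a ai].
  by apply: eq_bigr => l _; rewrite tensmxE mxE eqxx mul1r.
by apply: big1 => l _; rewrite tensmxE mxE eq_sym (negbTE ai) !mul0r.
Qed.

Lemma ptraceAE nA nB (K : 'M[C]_(nA * nB)) (rA : 'M[C]_nA) i j :
  ptraceA (nA := nA) ((rA *t 1%:M) *m K) i j =
  \sum_k \sum_l rA k l * K (mxtens_index (l, i)) (mxtens_index (k, j)).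
Proof.
rewrite mxE; apply: eq_bigr => k _; rewrite mxE sum_mxtens_index.
apply: eq_bigr => l _; rewrite (bigD1 i) //= [X in _ + X]big1 ?addr0 => [|a ai].
  by rewrite tensmxE mxE eqxx mulr1.
by rewrite tensmxE mxE eq_sym (negbTE ai) mulr0 mul0r.
Qed.

(** The product under the partial trace need not be Hermitian, but conjugating the entry formula
    merely exchanges the two summation indices over the traced factor. *)
Lemma ptraceB_hermitian nA nB (K : 'M[C]_(nA * nB)) (rB : 'M[C]_nB) :
  is_hermitian K -> is_hermitian rB ->
  is_hermitian (ptraceB (nB := nB) ((1%:M *t rB) *m K)).
Proof.
move=> /hermitianP hK /hermitianP hr; apply/hermitianP => i j.
rewrite !ptraceBE exchange_big rmorph_sum; apply: eq_bigr => k _ /=.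
by rewrite rmorph_sum; apply: eq_bigr => l _; rewrite rmorphM /= hK hr.
Qed.

Lemma ptraceA_hermitian nA nB (K : 'M[C]_(nA * nB)) (rA : 'M[C]_nA) :
  is_hermitian K -> is_hermitian rA ->
  is_hermitian (ptraceA (nA := nA) ((rA *t 1%:M) *m K)).
Proof.
move=> /hermitianP hK /hermitianP hr; apply/hermitianP => i j.
rewrite !ptraceAE exchange_big rmorph_sum; apply: eq_bigr => k _ /=.
by rewrite rmorph_sum; apply: eq_bigr => l _; rewrite rmorphM /= hK hr.
Qed.

(** For fixed [rB] the payoff is thus linear in [rA], represented by the very matrix that the
    Loewner constraint bounds. *)
Lemma tr_tens_ptraceB nA nB (K : 'M[C]_(nA * nB)) (rA : 'M[C]_nA) (rB : 'M[C]_nB) :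
  \tr ((rA *t rB) *m K) = \tr (rA *m ptraceB (nB := nB) ((1%:M *t rB) *m K)).
Proof.
rewrite /mxtrace sum_mxtens_index; apply: eq_bigr => a _; rewrite mxE.
under eq_bigr => b _ do rewrite mxE sum_mxtens_index.
rewrite exchange_big; apply: eq_bigr => c _ /=.
rewrite ptraceBE mulr_sumr; apply: eq_bigr => b _.
by rewrite mulr_sumr; apply: eq_bigr => l _; rewrite tensmxE mulrA.
Qed.

Lemma tr_tens_ptraceA nA nB (K : 'M[C]_(nA * nB)) (rA : 'M[C]_nA) (rB : 'M[C]_nB) :
  \tr ((rA *t rB) *m K) = \tr (rB *m ptraceA (nA := nA) ((rA *t 1%:M) *m K)).
Proof.
rewrite /mxtrace sum_mxtens_index exchange_big; apply: eq_bigr => b _; rewrite mxE.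
under eq_bigr => a _ do rewrite mxE sum_mxtens_index exchange_big.
rewrite exchange_big; apply: eq_bigr => c _ /=.
rewrite ptraceAE mulr_sumr; apply: eq_bigr => a _.
by rewrite mulr_sumr; apply: eq_bigr => l _; rewrite tensmxE mulrA [rA _ _ * _]mulrC.
Qed.

End Matrices.

(** In finite dimension a linear form is a finite combination of the continuous coordinates. *)
Lemma scalar_continuous (R : realType) m (f : 'rV[R]_m -> R) :
  scalar f -> continuous f.
Proof.
move=> lf.
have f0 : f 0 = 0 by have := lf (-1) 0 0; rewrite scaler0 addr0 mulN1r addNr.
have fD : {morph f : x y / x + y} by move=> x y; rewrite -[x]scale1r lf mul1r scale1r.
have fZ a x : f (a *: x) = a * f x by rewrite -[a *: x]addr0 lf f0 addr0.
have fE : f = fun x => \sum_i x 0 i * f (delta_mx 0 i).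
  apply/funext => x; rewrite [in LHS](row_sum_delta x) (big_morph f fD f0).
  by apply: eq_bigr => i _; rewrite fZ.
rewrite fE; apply: continuous_big => [|i _]; first exact: add_continuous.
have h1 : continuous (fun y : 'rV[R]_m => y 0 i) by move=> x; exact: coord_continuous.
have h2 : continuous (fun _ : 'rV[R]_m => f (delta_mx 0 i)) by exact: cst_continuous.
move=> x.
have := continuousM (h1 x) (h2 x).
exact.
Qed.

(** * Density matrices: convex combinations, real coordinates, compactness *)

Section Densities.
Variable R : realType.
Local Notation C := R[i].

Lemma ReD (a b : C) : complex.Re (a + b) = complex.Re a + complex.Re b.
Proof. by case: a b => [? ?] [? ?]. Qed.

Lemma ReZ (a : R) (b : C) : complex.Re (a%:C * b) = a * complex.Re b.
Proof. by case: b => [? ?] /=; rewrite mul0r subr0. Qed.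

Lemma Re_sum (J : Type) (s : seq J) (F : J -> C) :
  complex.Re (\sum_(j <- s) F j) = \sum_(j <- s) complex.Re (F j).
Proof. exact: (big_morph _ ReD). Qed.

Lemma Re_tr_sum n (J : Type) (s : seq J) (w : J -> R) (r : J -> 'M[C]_n) M :
  complex.Re (\tr ((\sum_(j <- s) (w j)%:C *: r j) *m M)) =
  \sum_(j <- s) w j * complex.Re (\tr (r j *m M)).
Proof.
rewrite mulmx_suml (big_morph _ (@mxtraceD _ n) (@mxtrace0 _ n)) Re_sum.
by apply: eq_bigr => j _; rewrite -scalemxAl /= mxtraceZ ReZ.
Qed.

Lemma payoff_suml nA nB (K : 'M[C]_(nA * nB)) (J : Type) (s : seq J)
    (w : J -> R) (r : J -> 'M[C]_nA) rB :
  payoff K (\sum_(j <- s) (w j)%:C *: r j) rB = \sum_(j <- s) w j * payoff K (r j) rB.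
Proof.
rewrite /payoff tr_tens_ptraceB Re_tr_sum; apply: eq_bigr => j _.
by rewrite tr_tens_ptraceB.
Qed.

Lemma payoff_sumr nA nB (K : 'M[C]_(nA * nB)) (J : Type) (s : seq J)
    (w : J -> R) rA (r : J -> 'M[C]_nB) :
  payoff K rA (\sum_(j <- s) (w j)%:C *: r j) = \sum_(j <- s) w j * payoff K rA (r j).
Proof.
rewrite /payoff tr_tens_ptraceA Re_tr_sum; apply: eq_bigr => j _.
by rewrite tr_tens_ptraceA.
Qed.

Lemma density_sum n (J : eqType) (s : seq J) (w : J -> R) (r : J -> 'M[C]_n) :
  (forall j, j \in s -> density (r j)) -> (forall j, 0 <= w j) ->
  \sum_(j <- s) w j = 1 -> density (\sum_(j <- s) (w j)%:C *: r j).
Proof.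
move=> dr w0 w1; split; last first.
  rewrite raddf_sum /= (eq_big_seq (fun j => (w j)%:C)) => [|j /dr[_ tr1]].
    by rewrite -rmorph_sum w1.
  by rewrite /= mxtraceZ tr1 mulr1.
split=> [|x].
  apply/hermitianP => i k; rewrite !summxE rmorph_sum.
  apply: eq_big_seq => j /dr[[/hermitianP h _] _].
  by rewrite !mxE; apply: etrans (rmorphM _ _ _) _; congr (_ * _);
     [exact: conjc_real | exact: h].
rewrite mulmx_sumr mulmx_suml summxE big_seq sumr_ge0 // => j /dr[[_ h] _].
by rewrite -scalemxAr -scalemxAl mxE mulr_ge0 // ler0c.
Qed.

Lemma density_exists n : (0 < n)%N -> exists r : 'M[C]_n, density r.
Proof.
case: n => // n _.
pose e : 'cV[C]_n.+1 := delta_mx 0 0.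
exists (((adj e *m e) 0 0)^-1 *: (e *m adj e)).
apply: density_rank1; apply/matrix0Pn; exists 0, 0.
by rewrite mxE !eqxx oner_eq0.
Qed.

(** This is the quadratic form at e_i + w e_j with w of modulus one; the two cross terms are
    conjugate and add up to twice a real part. *)
Lemma psd_entry n (A : 'M[C]_n) i j (w : C) : psd A -> w * conjc w = 1 ->
  0 <= complex.Re (A i i) + complex.Re (A j j) + 2 * complex.Re (w * A i j).
Proof.
case=> /hermitianP hA pA w1.
have := pA (delta_mx i 0 + w *: delta_mx j 0).
have -> : adj (delta_mx i 0 + w *: delta_mx j 0 : 'cV[C]_n) =
    delta_mx 0 i + conjc w *: delta_mx 0 j.
  apply/matrixP => a b; rewrite !mxE !ord1 !eqxx !andbT rmorphD rmorphM /=.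
  by rewrite !conjc_nat.
have E k l : (delta_mx 0 k : 'rV[C]_n) *m A *m (delta_mx l 0 : 'cV[C]_n) = (A k l)%:M.
  by apply/matrixP => a b; rewrite -rowE -colE !mxE !ord1 eqxx mulr1n.
rewrite !mulmxDl !mulmxDr -!scalemxAl -!scalemxAr !E !mxE !eqxx !mulr1n.
rewrite lecE => /andP[_]; rewrite -(hA j i) !ReD.
have -> : conjc w * (w * A j j) = A j j by rewrite mulrA [conjc w * w]mulrC w1 mul1r.
by case: (A i j) (w) => [a b] [c d] /=; lra.
Qed.

(* The real coordinates of a Hermitian A are the entries of Re A + Im A, whose
   symmetric and antisymmetric parts are Re A and Im A. *)
Definition hmx n (x : 'rV[R]_(n * n)) : 'M[C]_n :=
  \matrix_(i, j) Complex ((vec_mx x i j + vec_mx x j i) / 2)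
                         ((vec_mx x i j - vec_mx x j i) / 2).

Lemma hmx_linear n a (x y : 'rV[R]_(n * n)) :
  hmx (a *: x + y) = a%:C *: hmx x + hmx y.
Proof.
apply/matrixP => i j; rewrite !mxE; apply/eqP; rewrite eq_complex /=.
by apply/andP; split; apply/eqP; field.
Qed.

Lemma hmx_hermitian n (x : 'rV[R]_(n * n)) : is_hermitian (hmx x).
Proof.
apply/hermitianP => i j; rewrite !mxE; apply/eqP; rewrite eq_complex /=.
by apply/andP; split; apply/eqP; field.
Qed.

Lemma hmx_surj n (A : 'M[C]_n) : is_hermitian A -> exists x, hmx x = A.
Proof.
move=> /hermitianP hA.
exists (mxvec (\matrix_(i, j) (complex.Re (A i j) + complex.Im (A i j)))).
apply/matrixP => i j; rewrite mxE mxvecK !mxE -(hA j i).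
case: (A i j) => a b; apply/eqP; rewrite eq_complex /=.
by apply/andP; split; apply/eqP; field.
Qed.

Lemma vec_mx_hmx n (x : 'rV[R]_(n * n)) i j :
  vec_mx x i j = complex.Re (hmx x i j) + complex.Im (hmx x i j).
Proof. by rewrite !mxE /=; field. Qed.

(** Diagonal entries are at most 1, and [psd_entry] bounds real and imaginary parts of every entry
    by the mean of two diagonal ones; so each part is at most 1 in absolute value. *)
Lemma density_entry_le n (A : 'M[C]_n) i j : density A ->
  `|complex.Re (A i j) + complex.Im (A i j)| <= 2.
Proof.
move=> [pA tr1].
have d1 k : complex.Re (A k k) <= 1.
  have /(congr1 (@complex.Re R)) := tr1; rewrite Re_sum /= => <-.
  rewrite (bigD1 k) //= lerDl sumr_ge0 // => l _.
  (* With equal indices and w = 1 the inequality reads 0 <= 4 Re A_ll. *)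
  by have := @psd_entry _ A l l 1 pA; rewrite conjc1 !mul1r => /(_ erefl); lra.
have e (a b : R) : a ^+ 2 + b ^+ 2 = 1 ->
    0 <= complex.Re (A i i) + complex.Re (A j j) +
         2 * (a * complex.Re (A i j) - b * complex.Im (A i j)).
  move=> ab; have := @psd_entry _ A i j (Complex a b) pA.
  case: (A i j) => c d /= h; apply: h; apply/eqP; rewrite eq_complex /=.
  by apply/andP; split; apply/eqP; [rewrite -ab; ring | ring].
(* The phases 1, -1, i and -i isolate the real and imaginary parts with both signs. *)
have := e 1 0; have := e (-1) 0; have := e 0 1; have := e 0 (-1).
rewrite sqrrN expr1n expr0n /= addr0 add0r.
move=> /(_ erefl) e1 /(_ erefl) e2 /(_ erefl) e3 /(_ erefl) e4.
by have := d1 i; have := d1 j; rewrite ler_norml; lra.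
Qed.

(** Closed and bounded in real coordinates, where Hermiticity is built in. *)
Lemma density_compact n : compact [set x : 'rV[R]_(n * n) | density (hmx x)].
Proof.
have cX : closed [set x : 'rV[R]_(n * n) | density (hmx x)].
  (* Closedness: one real linear equation and a family of real linear inequalities indexed by [y].
     The imaginary parts vanish because [hmx x] is Hermitian. *)
  rewrite (_ : mkset _ =
    (fun x : 'rV[R]_(n * n) => complex.Re (\tr (hmx x))) @^-1` [set r | r = 1] `&`
    \bigcap_(y in [set: 'cV[C]_n])
      (fun x : 'rV[R]_(n * n) => complex.Re ((adj y *m hmx x *m y) 0 0))
        @^-1` [set r | 0 <= r]); last first.
    apply/seteqP; split=> x /=.
      move=> [[_ h] tr1]; rewrite tr1; split=> // y _ /=.
      by have := h y; rewrite lecE => /andP[].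
    move=> [tr1 h]; split; last first.
      apply/eqP; rewrite eq_complex tr1 eqxx /=.
      apply/eqP; rewrite (big_morph (@complex.Im R) (id1 := 0) (op1 := +%R)) //; last first.
        by move=> [? ?] [? ?].
      by apply: big1 => i _; rewrite mxE /= subrr mul0r.
    split=> [|y]; first exact: hmx_hermitian.
    have := adj_form y (hmx_hermitian x); have := h y I => /=.
    case: ((adj y *m hmx x *m y) 0 0) => a b /= a0 [b0].
    by rewrite lecE /= a0 andbT; apply/eqP; lra.
  apply: closedI.
    apply: preimage_closed; last exact: closed_eq.
    move=> x _; apply: scalar_continuous => a {}x y.
    by rewrite hmx_linear linearD /= mxtraceZ ReD ReZ.
  apply: closed_bigI => y _; apply: preimage_closed; last exact: closed_ge.
  move=> x _; apply: scalar_continuous => a {}x z.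
  by rewrite hmx_linear mulmxDr mulmxDl -scalemxAr -scalemxAl !mxE ReD ReZ.
(* Boundedness: each coordinate is Re + Im of an entry, so the set lies in the cube of side
   [-2, 2]. *)
apply: subclosed_compact cX
  (rV_compact (fun=> @segment_compact R (-2) 2)) _ => x /= dx k.
case/mxvec_indexP: k => i j.
have := density_entry_le i j dx; rewrite -vec_mx_hmx ler_norml.
by rewrite -{3}(vec_mxK x) mxvecE /= in_itv.
Qed.

End Densities.

(** * The game with payoff [K]: attained minima, minimax, saddle certificates *)

Section Game.
Variables (R : realType) (nA nB : nat) (K : 'M[R[i]]_(nA * nB)).
Hypothesis nA_gt0 : (0 < nA)%N.
Hypothesis hK : is_hermitian K.

Lemma ptraceB_geP (rB : 'M[R[i]]_nB) (u : R) : density rB ->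
  loewner_ge (ptraceB (nB := nB) ((1%:M *t rB) *m K)) (u%:C)%:M <->
  forall rA : 'M[R[i]]_nA, density rA -> u <= payoff K rA rB.
Proof.
move=> [[hB _] _]; have hP := ptraceB_hermitian hK hB.
by split=> [/(loewner_ge_scalarP _ hP) h rA|h];
  last apply/(loewner_ge_scalarP _ hP) => rA;
  move=> /h; rewrite /payoff tr_tens_ptraceB.
Qed.

Lemma ptraceA_leP (rA : 'M[R[i]]_nA) (u : R) : density rA ->
  loewner_ge (u%:C)%:M (ptraceA (nA := nA) ((rA *t 1%:M) *m K)) <->
  forall rB : 'M[R[i]]_nB, density rB -> payoff K rA rB <= u.
Proof.
move=> [[hA _] _]; have hP := ptraceA_hermitian hK hA.
by split=> [/(scalar_loewner_geP _ hP) h rB|h];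
  last apply/(scalar_loewner_geP _ hP) => rB;
  move=> /h; rewrite /payoff tr_tens_ptraceA.
Qed.

Lemma payoff_hmx_continuous (rB : 'M[R[i]]_nB) :
  continuous (fun x : 'rV[R]_(nA * nA) => payoff K (hmx x) rB).
Proof.
apply: scalar_continuous => a x y; rewrite /payoff !tr_tens_ptraceB hmx_linear.
by rewrite mulmxDl -scalemxAl mxtraceD mxtraceZ ReD ReZ.
Qed.

Lemma density_hmx_nonempty : [set x : 'rV[R]_(nA * nA) | density (hmx x)] !=set0.
Proof.
have [r dr] := density_exists R nA_gt0; have [x xr] := hmx_surj dr.1.1.
by exists x => /=; rewrite xr.
Qed.

(** Maximality in [in_PhiB] compares attained minima only; attainment, by compactness, lets it apply
    to every density [rB']. *)
Lemma min_value_exists (rB : 'M[R[i]]_nB) :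
  exists v, is_min_value (nA := nA) K rB v.
Proof.
have [c /set_mem dc cmin] := compact_EVT_min density_hmx_nonempty
  (@density_compact R nA) (continuous_subspaceT (@payoff_hmx_continuous rB)).
exists (payoff K (hmx c) rB); split; first by exists (hmx c).
move=> rA dA; have [x xA] := hmx_surj dA.1.1; rewrite -xA.
by apply: cmin; rewrite inE /= xA.
Qed.

(** The abstract minimax theorem with player A on the compact side in the coordinates of [hmx].
    Bilinearity and [density_sum] supply the convexity conditions, with equality. *)
Lemma quantum_minimax (v : R) :
  (forall rB : 'M[R[i]]_nB, density rB ->
     exists2 rA : 'M[R[i]]_nA, density rA & payoff K rA rB <= v) ->
  exists2 rA : 'M[R[i]]_nA, density rA &
    forall rB : 'M[R[i]]_nB, density rB -> payoff K rA rB <= v.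
Proof.
move=> hv.
have [||||x dx hx] := @minimax R 'rV[R]_(nA * nA) 'M[R[i]]_nB
  [set x | density (hmx x)] [set rB | density rB]
  (fun x rB => payoff K (hmx x) rB) v density_hmx_nonempty (@density_compact R nA).
- by move=> rB _; exact: payoff_hmx_continuous.
- move=> x y t dx dy /andP[t0 t1].
  (* The segment from [x] to [y] as a sum over booleans, to fit [density_sum] and [payoff_suml]. *)
  pose w b := if b then t else 1 - t; pose r b := hmx (if b then y else x).
  have dr : density (\sum_(b <- [:: false; true]) (w b)%:C *: r b).
    apply: density_sum; [by case | by case => /=; lra | ].
    by rewrite !big_cons big_nil /w; ring.
  have [z zE] := hmx_surj dr.1.1; exists z; first by rewrite /= zE.
  by move=> rB _; rewrite zE payoff_suml !big_cons big_nil addr0.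
- move=> s w sY w0 w1; exists (\sum_(r <- s) (w r)%:C *: r).
    exact: density_sum.
  by move=> x _; rewrite payoff_sumr.
- move=> rB /hv [rA dA le]; have [x xA] := hmx_surj dA.1.1.
  by exists x => /=; rewrite xA.
by exists (hmx x).
Qed.

(** Forwards, maximality of [v] gives every [rB'] a reply with payoff at most [v], and minimax turns
    these into a single [Om]. Backwards is weak duality: [Om] caps every minimum by [u], and at [rB]
    both bounds meet. *)
Lemma in_PhiB_saddleP (rB : 'M[R[i]]_nB) : density rB ->
  in_PhiB (nA := nA) K rB <->
  exists (Om : 'M[R[i]]_nA) (u : R), [/\ density Om,
    forall rA : 'M[R[i]]_nA, density rA -> u <= payoff K rA rB &
    forall rB' : 'M[R[i]]_nB, density rB' -> payoff K Om rB' <= u].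
Proof.
move=> dB; split=> [[_ [v [[_ vmin] vmax]]]|[Om [u [dO hA hB]]]].
  have [rB' dB'|Om dO hO] := @quantum_minimax v; last by exists Om, v.
  have [v' mv'] := min_value_exists rB'; have [[rA [dA pA]] _] := mv'.
  by exists rA => //; rewrite pA; exact: vmax mv'.
split=> //; exists u; split; first split=> //.
  by exists Om; split=> //; apply/eqP; rewrite eq_le hA ?hB.
by move=> rB' v' dB' [_ mv']; exact: le_trans (mv' _ dO) (hB _ dB').
Qed.

End Game.

(** * Transfer of optimality between the two programs *)

Lemma hermitianD (R : realType) n (A B : 'M[R[i]]_n) :
  is_hermitian A -> is_hermitian B -> is_hermitian (A + B).
Proof.
move=> /hermitianP hA /hermitianP hB; apply/hermitianP => i j.
by rewrite !mxE rmorphD /= hA hB.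
Qed.

Theorem theorem2 (R : realType) (nA nB : nat) (H : 'M[R[i]]_(nA * nB)) (Delta : R)
  (rA : 'M[R[i]]_nA) (D : 'M[R[i]]_(nA * nB)) (rB : 'M[R[i]]_nB)
  (Om : 'M[R[i]]_nA) (u : R) :
  (0 < nA)%N -> (0 < nB)%N -> is_hermitian H -> 0 <= Delta ->
  sdp_optimal H Delta rA D rB Om u ->
  bilevel_optimal H Delta rA D rB.
Proof.
move=> nA0 _ hH _ [[cB cA [hD nD] [pA pB pO] [tA tB tO]] opt].
have hK := hermitianD hH hD.
split.
  (* The auxiliary variables of the semidefinite program are themselves the saddle certificate. *)
  split=> //; apply/in_PhiB_saddleP => //; exists Om, u.
  by split=> //; [exact/ptraceB_geP | exact/ptraceA_leP].
move=> rA' D' rB' [[pA' tA'] dB' [hD' nD'] /(in_PhiB_saddleP _ nA0 dB')].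
move=> [Om' [u' [dO' geA leB]]]; have hK' := hermitianD hH hD'.
(* A certificate for the competitor completes it to a feasible point of the semidefinite program
   with the same objective. *)
apply: (opt rA' D' rB' Om' u'); split.
- exact/(ptraceB_geP hK').
- exact/(ptraceA_leP hK').
- exact: conj hD' nD'.
- by case: dB' dO' => [? _] [? _]; split.
- by case: dB' dO' => [_ ?] [_ ?]; split.
Qed.
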